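(* Let $k$ be a positive integer and let $G$ be a connected claw-free graph. If $\sigma_{2}(G)\geq |G|-k-1$, then $G$ has a spanning tree $T$ with at most $k+1$ leaves and branch vertices in total, i.e. $|L(T)|+|B(T)|\leq k+1$.
   Context: All graphs are finite and simple (no loops). $|G|$ denotes the number of vertices of $G$, and $\deg_G(v)$ the degree of $v$ in $G$. A graph is claw-free if it does not contain $K_{1,3}$ as an induced subgraph. $\alpha(G)$ denotes the largest size of an independent set of $G$. For an integer $j\geq 1$, $\sigma_j(G)=+\infty$ if $\alpha(G)<j$, and otherwise $\sigma_j(G)=\min\{\sum_{i=1}^j \deg_G(v_i) : \{v_1,\dots,v_j\}\text{ is an independent set of } j \text{ vertices of } G\}$. For a tree $T$, a leaf is a vertex of degree one in $T$ and a branch vertex is a vertex of degree at least three in $T$; $L(T)$ and $B(T)$ denote the sets of leaves and branch vertices of $T$, respectively. Inequalities are between (extended) real numbers, so the right-hand side may be negative. *)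

(* Defs.v *)
From HB Require Import structures.
From mathcomp Require Import all_boot all_order all_algebra.
From mathcomp Require Import constructive_ereal.
Set Implicit Arguments.
Unset Strict Implicit.
Unset Printing Implicit Defensive.
Import Order.TTheory GRing.Theory Num.Theory.

Record sgraph (V : finType) := SGraph {
  adj :> rel V;
  adj_sym : symmetric adj;
  adj_irrefl : irreflexive adj }.

Section Graphs.
Variable V : finType.
Implicit Types (G T : sgraph V) (A : {set V}).

Definition deg G (v : V) : nat := #|[set u | G v u]|.

(* The graph without vertices is not connected. *)
Definition connected G : Prop := 0 < #|V| /\ forall x y : V, connect G x y.

(* Vertex 0 is the centre of K_{1,3}. *)
Definition claw : rel 'I_4 := fun i j => (i == ord0) != (j == ord0).

Definition claw_free G : Prop :=
  ~ exists2 f : 'I_4 -> V, injective f & forall i j, G (f i) (f j) = claw i j.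

Definition independent G A : bool :=
  [forall x in A, forall y in A, ~~ G x y].

Definition alpha G : nat := \max_(A : {set V} | independent G A) #|A|.

(* Degree sums are integers, so extended integers suffice; in the second
   branch the minimum is over a nonempty family, and the neutral element +oo
   does not contribute. *)
Definition sigma (j : nat) G : \bar int :=
  if alpha G < j then +oo%E
  else \big[Order.min/+oo%E]_(A : {set V} | independent G A && (#|A| == j))
         ((\sum_(v in A) deg G v)%N%:Z)%:E.

(* An edge traversed back and forth is a duplicate-free cycle of size 2 for
   ucycle, hence the bound on the size. *)
Definition acyclic G : Prop := forall c : seq V, ucycle G c -> size c < 3.

Definition tree T : Prop := connected T /\ acyclic T.

Definition spanning_tree G T : Prop := subrel T G /\ tree T.

Definition leaves T : {set V} := [set v | deg T v == 1].

Definition branch_vertices T : {set V} := [set v | 3 <= deg T v].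

End Graphs.

(* Main.v *)
Require Import Defs.
From mathcomp Require Import all_boot all_order all_algebra.
From mathcomp Require Import constructive_ereal.
From mathcomp Require Import zify.
From Stdlib Require Import Classical.
Import Order.TTheory GRing.Theory Num.Theory.
Set Implicit Arguments.
Unset Strict Implicit.
Unset Printing Implicit Defensive.

(** Let T be a spanning tree of G for which |L(T)| + |B(T)| is smallest, and
    let s be that number.  If T has at most two leaves it has no branch vertex
    and s <= 2 <= k + 1.  Otherwise two nonadjacent leaves x and y satisfy
    deg_G x + deg_G y + s <= |G|, and the hypothesis, applied to x and y, gives
    |G| - k - 1 <= |G| - s, which is the claim.

    The inequality is a count around T rooted at x.  For a G-neighbour v of x
    with parent u, the tree T + xv - vu would be better than T unless u has
    degree 2 or u = x ([parent_deg2]); when u has degree 2 that tree is as good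
    as T and has u as a leaf in place of x.  Since the leaves of an optimal
    tree with three leaves are pairwise nonadjacent in G
    ([leaves_nonadjacent]), such a u is not adjacent to y
    ([parent_nonadjacent]), and neither is x.  So the set A of the parents of
    N(x) is disjoint from N(y), and |A| = deg_G x because the root x and a
    parent of degree 2 have one child each.

    It remains to find s vertices outside A and N(y), one for each leaf and
    each branch vertex.  Leaves other than x qualify, and so do the branch
    vertices not adjacent to y.  Let b be a branch vertex adjacent to y, and
    consider the children of b for the root y.  None of them is adjacent to y,
    so they form a clique because G is claw-free; moving edges within this
    clique shows that they all have degree 2 ([child_deg2]).  A child of b that
    is not on the way to x lies outside A and N(y) and serves in place of b.

    One more vertex is needed, in place of x.  Some leaf z has a neighbour z1 of
    degree 2, as otherwise the leaves would embed into the branch vertices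
    ([leaf_deg2_nbr]).  Claw-freeness at z1, or at the next vertex of T when
    that is a branch vertex, lets one name the other leaves x and y so that z1
    is outside A and N(y) and was not used for any b ([choose_leaves]).

    Every exchange of an edge cd of T for an edge ab of G is justified in the
    same way: a connected graph with 2(|G| - 1) as degree sum is a tree, so only
    a path from c to d in the new graph has to be shown. *)

(** * Degrees and neighbours *)

Section Trees.
Variable V : finType.
Implicit Types (G H S T : sgraph V) (x y z u v w a b c d q : V).

Lemma deg_sum T v : deg T v = \sum_w (T v w : nat).
Proof.
rewrite /deg -sum1dep_card big_mkcond; apply: eq_bigr => w _.
by case: (T v w).
Qed.

Lemma sub_deg S T v : subrel S T -> deg S v <= deg T v.
Proof.
by move=> sST; apply/subset_leq_card/subsetP => w; rewrite !inE; apply: sST.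
Qed.

Lemma leq_deg2 T v a b : T v a -> T v b -> a != b -> 1 < deg T v.
Proof.
move=> va vb ab; have <- : #|[set a; b]| = 2 by rewrite cards2 ab.
by apply/subset_leq_card/subsetP => w /set2P[] ->; rewrite inE.
Qed.

Lemma leq_deg3 T v a b c :
  T v a -> T v b -> T v c -> a != b -> a != c -> b != c -> 2 < deg T v.
Proof.
move=> va vb vc ab ac bc; have <- : #|c |: [set a; b]| = 3.
  by rewrite cardsU1 cards2 ab !inE ![c == _]eq_sym (negPf ac) (negPf bc).
by apply/subset_leq_card/subsetP => w /setU1P[->|/set2P[] ->]; rewrite inE.
Qed.

Lemma deg1_nbr T v a b : deg T v = 1 -> T v a -> T v b -> a = b.
Proof.
move=> dv va vb; apply/eqP; case: eqP => // /eqP ab.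
by have := leq_deg2 va vb ab; rewrite dv.
Qed.

Lemma deg2_nbr T v a b c :
  deg T v = 2 -> T v a -> T v b -> T v c -> a != b -> a != c -> b = c.
Proof.
move=> dv va vb vc ab ac; apply/eqP; case: eqP => // /eqP bc.
by have := leq_deg3 va vb vc ab ac bc; rewrite dv.
Qed.

Lemma deg2_other T v a : deg T v = 2 -> exists2 b, T v b & b != a.
Proof.
move=> dv; have /card_gt0P[b] : 0 < #|[set u | T v u] :\ a|.
  by have := cardsD1 a [set u | T v u]; rewrite -/(deg T v) dv; lia.
by rewrite !inE => /andP[ba vb]; exists b.
Qed.

Lemma deg3_other T v a a' :
  2 < deg T v -> exists b, [/\ T v b, b != a & b != a'].
Proof.
move=> dv; have /card_gt0P[b] : 0 < #|[set u | T v u] :\ a :\ a'|.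
  have := cardsD1 a [set u | T v u]; rewrite -/(deg T v).
  by have := cardsD1 a' ([set u | T v u] :\ a); lia.
by rewrite !inE => /and3P[ba' ba vb]; exists b.
Qed.

(** * Rooted trees *)

Definition avoid T v : rel V := [rel a b | [&& T a b, a != v & b != v]].

Lemma avoidE T v a b : avoid T v a b = [&& T a b, a != v & b != v].
Proof. by []. Qed.

(** In a tree, u is the parent of v for the root x.  Keeping the root as an
    argument lets one tree be rooted at several leaves at once. *)
Definition toward T x v u : bool := T v u && connect (avoid T v) x u.

Lemma connect_sym_adj T : connect_sym T.
Proof. by apply: sym_connect_sym; apply: adj_sym. Qed.

Lemma avoid_sym T v : connect_sym (avoid T v).
Proof.
apply: sym_connect_sym => a b.
by rewrite !avoidE (adj_sym T a) [(b != v) && _]andbC.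
Qed.

Lemma path_avoid T v a p :
  path T a p -> v \notin a :: p -> path (avoid T v) a p.
Proof.
move=> pth vp; apply: (@sub_in_path _ (predC1 v) T) pth.
- by move=> u w; rewrite !inE avoidE => -> -> ->.
- by apply/allP => u up; apply: contraNneq vp => <-.
Qed.

Lemma avoid_path T v a p : path (avoid T v) a p -> path T a p.
Proof. by apply: sub_path => u w /and3P[]. Qed.

Lemma towardN T x v u : toward T x v u -> x != v.
Proof.
case/andP=> vu /connectP[[|w p] /=].
  by move=> _ <-; apply: contraTneq vu => ->; rewrite adj_irrefl.
by case/andP=> /and3P[].
Qed.

Lemma connect_last (e : rel V) x v : connect e x v -> x != v ->
  exists p, [/\ path e x p, e (last x p) v & uniq (x :: rcons p v)].
Proof.
case/connectP=> p0 /shortenP[p] + + _ def_v; case/lastP: p def_v => [|p w] ->.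
  by rewrite eqxx.
by rewrite last_rcons rcons_path => /andP[pth e_v] un _; exists p.
Qed.

Lemma path_toward T x v p :
  path T x p -> T (last x p) v -> uniq (x :: rcons p v) ->
  toward T x v (last x p).
Proof.
move=> pth e; rewrite -rcons_cons rcons_uniq => /andP[vp _].
rewrite /toward adj_sym e; apply/connectP; exists p => //.
exact: path_avoid.
Qed.

Lemma connect_toward T x v :
  connect T x v -> x != v -> exists u, toward T x v u.
Proof.
move=> cxv xv; have [p [pth e un]] := connect_last cxv xv.
by exists (last x p); apply: path_toward.
Qed.

(** Two neighbours of v joined outside v would close a cycle through v. *)
Lemma toward_uniq T x v u u' :
  acyclic T -> toward T x v u -> toward T x v u' -> u = u'.
Proof.
move=> acT /andP[vu xu] /andP[vu' xu'].
have uu' : connect (avoid T v) u u'.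
  by rewrite avoid_sym in xu; apply: connect_trans xu'.
apply/eqP; apply: contraT => /(connect_last uu')[p [pth e un]].
have /avoid_path : path (avoid T v) u (rcons p u') by rewrite rcons_path pth.
have vp : v \notin u :: rcons p u'.
  rewrite -rcons_cons mem_rcons !inE; apply/norP; split.
    by apply: contraTneq vu' => ->; rewrite adj_irrefl.
  rewrite negb_or; apply/andP; split.
    by apply: contraTneq vu => ->; rewrite adj_irrefl.
  elim: p u pth {xu vu uu' e un} => //= w p IHp u1 /andP[].
  by rewrite avoidE inE negb_or [v == w]eq_sym => /and3P[_ _ ->] /IHp.
move=> pth'; have := acT (v :: u :: rcons p u').
rewrite /= size_rcons /ucycle (cons_uniq v) vp un /= andbT rcons_path last_rcons.
by rewrite vu pth' (adj_sym T u') vu' => /(_ isT).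
Qed.

Lemma toward_asym T x u w : acyclic T -> toward T x u w -> ~~ toward T x w u.
Proof.
move=> acT xuw; apply/negP=> xwu; have xw := towardN xwu.
case/andP: xuw => uw xw_u; have [p [pth e un]] := connect_last xw_u xw.
move: e; rewrite avoidE => /and3P[e rNu _].
have := toward_uniq acT xwu (path_toward (avoid_path pth) e un).
by move=> def_u; rewrite -def_u eqxx in rNu.
Qed.

(** A path from x to u either passes through w or extends to w. *)
Lemma toward_total T x u w :
  connect T x u -> T u w -> toward T x u w || toward T x w u.
Proof.
move=> cxu uw; have [->|xu] := eqVneq x u.
  by rewrite orbC /toward adj_sym uw connect0.
have [p [pth e un]] := connect_last cxu xu.
move: (un); rewrite -rcons_cons rcons_uniq => /andP[up _].
have pthu := path_avoid pth up.
have [wp|wp] := boolP (w \in x :: p).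
  by rewrite /toward uw (path_connect pthu wp).
have wu : w != u by apply: contraTneq uw => ->; rewrite adj_irrefl.
rewrite orbC /toward adj_sym uw; apply/orP; left; apply/connectP.
exists (rcons p u); last by rewrite last_rcons.
apply: path_avoid; first by rewrite rcons_path pth.
by rewrite -rcons_cons mem_rcons inE negb_or wu.
Qed.

(** Root the tree: each edge has one end as the child of the other, and every
    vertex but the root is a child once. *)
Lemma tree_deg_sum T : tree T -> (\sum_v deg T v).+2 = 2 * #|V|.
Proof.
case=> -[/card_gt0P[x _] cT] acT.
have E u w : (T u w : nat) = toward T x u w + toward T x w u.
  have [uw|uw] := boolP (T u w); last first.
    by rewrite /toward (negPf uw) adj_sym (negPf uw).
  have := toward_total (cT x u) uw; have := @toward_asym T x u w acT.
  by case: (toward T x u w) => [/(_ isT)/negPf->|_ /= ->].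
have N v : \sum_u (toward T x v u : nat) = (v != x).
  have [->|vx] /= := eqVneq v x.
    apply: big1 => u _; case: (boolP (toward T x x u)) => // /towardN.
    by rewrite eqxx.
  have [|u xvu] := connect_toward (cT x v); first by rewrite eq_sym.
  rewrite (bigD1 u) //= xvu big1 // => w wu.
  by apply/eqP; rewrite eqb0; apply: contraNN wu => /(toward_uniq acT xvu)->.
have -> : \sum_v deg T v = 2 * \sum_v (v != x : nat).
  under eq_bigr => v _ do rewrite deg_sum.
  under eq_bigr => v _ do under eq_bigr => w _ do rewrite E.
  under eq_bigr => v _ do rewrite big_split /=.
  rewrite big_split /= [in X in _ + X]exchange_big /= mul2n -addnn.
  by congr (_ + _); apply: eq_bigr => v _; rewrite N.
have : \sum_v (v != x : nat) + 1 = #|V|; last by lia.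
rewrite -sum1_card (bigD1 x) // [RHS](bigD1 x) //= eqxx add0n addnC; congr (_ + _).
by apply: eq_bigr => v ->.
Qed.

Lemma deg_gt0 T u v : connected T -> u != v -> 0 < deg T v.
Proof.
move=> cT uv; have [w /andP[vw _]] := connect_toward (proj2 cT u v) uv.
by apply/card_gt0P; exists w; rewrite inE.
Qed.

(** Sum 2 + [deg >= 3] <= deg + [deg = 1] over the vertices. *)
Lemma leaves_branches T :
  tree T -> 1 < #|V| -> #|branch_vertices T| + 2 <= #|leaves T|.
Proof.
move=> tT; rewrite -cardsT => /card_gt1P[u [v [_ _ uv]]].
have d0 w : 0 < deg T w.
  have [<-|uw] := eqVneq u w; last exact: deg_gt0 (proj1 tT) uw.
  by apply: deg_gt0 (proj1 tT) _; rewrite eq_sym; apply: uv.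
have : \sum_w (2 + (3 <= deg T w)) <= \sum_w (deg T w + (deg T w == 1)).
  apply: leq_sum => w _; have := d0 w; clear.
  by case: (deg T w) => [|[|[|n]]].
have cardE (P : pred V) : \sum_w (P w : nat) = #|[set w | P w]|.
  rewrite -sum1dep_card [RHS]big_mkcond; apply: eq_bigr => w _.
  by case: (P w).
rewrite !big_split /= sum_nat_const !cardE.
rewrite -/(leaves T) -/(branch_vertices T).
by have := tree_deg_sum tT; rewrite -[#|xpredT|]/#|V|; clear; lia.
Qed.

(** * Exchanging edges *)

Definition ends a b : rel V :=
  [rel u w | (u == a) && (w == b) || (u == b) && (w == a)].

Lemma endsC a b u w : ends a b u w = ends a b w u.
Proof. by rewrite /ends /= orbC andbC [X in _ || X]andbC. Qed.

Lemma endsN a b u w : u != a -> u != b -> ends a b u w = false.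
Proof. by rewrite /ends /= => /negPf-> /negPf->. Qed.

Definition cut_adj T a b : rel V := [rel u w | T u w && ~~ ends a b u w].

Lemma cut_sym T a b : symmetric (cut_adj T a b).
Proof. by move=> u w; rewrite /cut_adj /= adj_sym endsC. Qed.

Lemma cut_irrefl T a b : irreflexive (cut_adj T a b).
Proof. by move=> u; rewrite /cut_adj /= adj_irrefl. Qed.

Definition cut T a b := SGraph (@cut_sym T a b) (@cut_irrefl T a b).

(** The graph T - cd + ab.  The guard u != w makes it irreflexive even when
    a = b, so that swap is defined without side conditions. *)
Definition swap_adj T a b c d : rel V :=
  [rel u w | (u != w) && (T u w && ~~ ends c d u w || ends a b u w)].

Lemma swap_sym T a b c d : symmetric (swap_adj T a b c d).
Proof. by move=> u w; rewrite /swap_adj /= adj_sym eq_sym endsC (endsC a b). Qed.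

Lemma swap_irrefl T a b c d : irreflexive (swap_adj T a b c d).
Proof. by move=> u; rewrite /swap_adj /= eqxx. Qed.

Definition swap T a b c d :=
  SGraph (@swap_sym T a b c d) (@swap_irrefl T a b c d).

Lemma cutE T a b u w : cut T a b u w = T u w && ~~ ends a b u w.
Proof. by []. Qed.

Lemma swapE T a b c d u w : a != b ->
  swap T a b c d u w = T u w && ~~ ends c d u w || ends a b u w.
Proof.
move=> ab; rewrite /swap /swap_adj /=; have [<-|//] := eqVneq u w.
rewrite adj_irrefl /=.
by apply/esym/negbTE; apply: contraNN ab => /orP[]/andP[/eqP<- /eqP<-].
Qed.

Lemma swap_old T a b c d u w : T u w -> ~~ ends c d u w -> swap T a b c d u w.
Proof.
move=> uw cd; apply/andP; split; last by rewrite uw cd.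
by apply: contraTneq uw => ->; rewrite adj_irrefl.
Qed.

Lemma swap_new T a b c d : a != b -> swap T a b c d a b.
Proof. by move=> ab; rewrite swapE // /ends /= !eqxx orbT. Qed.

(** Written additively, because subtraction of natural numbers truncates and
    because the two edges may share an end. *)
Lemma deg_swap T a b c d v : a != b -> T c d -> ~~ T a b ->
  deg (swap T a b c d) v + ((v == c) + (v == d))
    = deg T v + ((v == a) + (v == b)).
Proof.
have E e f : e != f -> (v == e) + (v == f) = \sum_w (ends e f v w : nat).
  move=> ef; rewrite /ends /=; have [->|ve] := eqVneq v e.
    by rewrite (negPf ef) (bigD1 f) //= eqxx big1 // => w /negPf->.
  have [_|_] /= := eqVneq v f; last by rewrite big1_eq.
  by rewrite (bigD1 e) //= eqxx big1 // => w /negPf->.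
move=> ab Tcd Tab; have cd : c != d by apply: contraTneq Tcd => ->; rewrite adj_irrefl.
rewrite (E c d cd) (E a b ab) !deg_sum -!big_split; apply: eq_bigr => w _.
rewrite swapE //=.
have P e f : ends e f v w -> T v w = T e f.
  by case/orP=> /andP[/eqP-> /eqP->] //; rewrite adj_sym.
case: (boolP (ends c d v w)) => [/P|_]; case: (boolP (ends a b v w)) => [/P|_].
- by rewrite (negPf Tab) => ->; rewrite Tcd.
- by move=> ->; rewrite Tcd.
- by rewrite (negPf Tab) => ->.
- by rewrite andbT orbF.
Qed.

Lemma deg_swapN T a b c d v : a != b -> T c d -> ~~ T a b ->
  v != a -> v != b -> v != c -> v != d -> deg (swap T a b c d) v = deg T v.
Proof.
move=> ab cd nab /negPf va /negPf vb /negPf vc /negPf vd.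
by have := deg_swap v ab cd nab; rewrite va vb vc vd !addn0.
Qed.

Lemma connected_but T T' c d : connected T ->
    (forall u w, T u w -> ~~ ends c d u w -> T' u w) -> connect T' c d ->
  connected T'.
Proof.
case=> V0 cT sub cd; split=> // x y; move: (cT x y); apply: connect_sub => u w uw.
have [/orP[]/andP[/eqP-> /eqP->]|nuw] := boolP (ends c d u w) => //.
  by rewrite connect_sym_adj.
by apply/connect1/sub.
Qed.

Lemma cut_cycle T (c : seq V) : connected T -> ucycle T c -> 2 < size c ->
  exists a b, T a b /\ connected (cut T a b).
Proof.
case: c => [|a [|b [|d c]]] // cT; rewrite /ucycle /= => /andP[].
case/and3P=> ab bd; rewrite rcons_path => /andP[pth e] un _.
exists a, b; split=> //.
apply: (connected_but (c := a) (d := b) cT) => [u w|].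
  by rewrite cutE => -> ->.
have {un} [anb and_ ac bnd bc] :
    [/\ a != b, a != d, a \notin c, b != d & b \notin c].
  by move: un; rewrite !inE !negb_or -!andbA => /and5P[-> -> -> -> /andP[->]].
rewrite connect_sym_adj; apply: (@connect_trans _ _ d).
  by apply: connect1; rewrite cutE bd endsC endsN // eq_sym.
apply: (@connect_trans _ _ (last d c)); last first.
  apply: connect1; rewrite cutE e /=; set l := last d c.
  have ll : l \in d :: c by apply: mem_last.
  by rewrite endsN //; apply: contraTneq ll => ->; rewrite inE negb_or ?and_ ?bnd.
apply/connectP; exists c => //.
apply: (@sub_in_path _ (predC1 a) T) pth.
  move=> u w; rewrite !inE cutE /ends /= => /negPf-> /negPf-> ->.
  by rewrite !andbF.
rewrite /= eq_sym and_; apply/allP=> u uc /=.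
by apply: contraNneq ac => <-.
Qed.

(** Open cycles one edge at a time. *)
Lemma spanning_subtree T : connected T -> exists S, spanning_tree T S.
Proof.
have [m] := ubnP (\sum_v deg T v); elim: m T => // m IHm T lt_m cT.
have [acT|] := classic (acyclic T); first by exists T; do 2?split.
move=> nacT; have [c nc] := not_all_ex_not _ _ nacT.
have [cyc /negP] := imply_to_and _ _ nc.
rewrite -leqNgt => sz; have [a [b [ab cT']]] := cut_cycle cT cyc sz.
have sub : subrel (cut T a b) T by move=> u w /andP[].
have [|S [sS tS]] := IHm (cut T a b) _ cT'.
  rewrite ltnS in lt_m; apply: leq_trans lt_m.
  rewrite (bigD1 a) // [X in _ < X](bigD1 a) //= -addSn leq_add //.
    apply: proper_card; apply/properP; split.
      by apply/subsetP=> w; rewrite !inE => /andP[].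
    by exists b; rewrite !inE ?cutE //= ab /ends /= !eqxx.
  by apply: leq_sum => v _; apply: sub_deg.
by exists S; split=> // u w /sS; apply: sub.
Qed.

(** A spanning subtree already uses up the whole degree sum, hence all edges. *)
Lemma connected_deg_sum_tree T :
  connected T -> (\sum_v deg T v).+2 <= 2 * #|V| -> tree T.
Proof.
move=> cT leT; split=> // c; have [S [sS tS]] := spanning_subtree cT.
have E v : deg S v = deg T v.
  apply/eqP; rewrite eqn_leq sub_deg //=.
  have := tree_deg_sum tS; move: leT; rewrite (bigD1 v) //= [in _ = 2 * _](bigD1 v) //=.
  have : \sum_(i | i != v) deg S i <= \sum_(i | i != v) deg T i.
    by apply: leq_sum => i _; apply: sub_deg.
  by lia.
have ST : S =2 T.
  move=> u w; have /eqP : [set t | S u t] = [set t | T u t].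
    by apply/eqP; rewrite eqEcard; apply/andP; split;
      [apply/subsetP => t; rewrite !inE; apply: sS | rewrite -/(deg T u) -E].
  by move/eqP/setP/(_ w); rewrite !inE.
by move=> cyc; apply: (proj2 tS); move: cyc; rewrite /ucycle (eq_cycle ST).
Qed.

(** The degree sum does not change, so connectedness is the only concern. *)
Lemma swap_spanning G T a b c d : spanning_tree G T -> a != b -> G a b ->
    ~~ T a b -> T c d -> connect (swap T a b c d) c d ->
  spanning_tree G (swap T a b c d).
Proof.
move=> [sT tT] ab Gab Tab Tcd con; split.
  move=> u w /andP[_ /orP[/andP[/sT] //|]].
  by case/orP=> /andP[/eqP-> /eqP->] //; rewrite adj_sym.
apply: connected_deg_sum_tree.
  by apply: connected_but con; [case: tT | move=> u w; apply: swap_old].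
rewrite -(tree_deg_sum tT) !ltnS.
have : \sum_v (deg (swap T a b c d) v + ((v == c) + (v == d)))
    = \sum_v (deg T v + ((v == a) + (v == b))).
  by apply: eq_bigr => v _; apply: deg_swap.
have one e : \sum_v (v == e : nat) = 1.
  by rewrite (bigD1 e) //= eqxx big1 // => v /negPf->.
by rewrite !big_split /= !one => /addIn ->.
Qed.

Lemma spanning_connected G T x y : spanning_tree G T -> connect T x y.
Proof. by case=> _ [[]]. Qed.

Lemma spanning_acyclic G T : spanning_tree G T -> acyclic T.
Proof. by case=> _ []. Qed.

(** The edge that is removed meets c, so paths around c survive. *)
Lemma connect_avoid_swap T a b c d u w :
  connect (avoid T c) u w -> connect (avoid (swap T a b c d) c) u w.
Proof.
apply: connect_sub => s t; rewrite avoidE => /and3P[st sc tc].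
apply: connect1; rewrite avoidE sc tc swap_old //.
by rewrite /ends /= (negPf sc) (negPf tc) andbF.
Qed.

Lemma connect_swap T a b c d u w :
  connect (avoid T c) u w -> connect (swap T a b c d) u w.
Proof.
move/(connect_avoid_swap a b d); apply: connect_sub => s t.
by rewrite avoidE => /and3P[st _ _]; apply: connect1.
Qed.

Lemma endsF b c c' : b != c -> c' != c -> ~~ ends b c b c'.
Proof. by rewrite /ends /= => /negPf-> /negPf->; rewrite andbF. Qed.

Lemma adj_neq T a b : T a b -> a != b.
Proof. by apply: contraTneq => ->; rewrite adj_irrefl. Qed.

Lemma toward_adj T x v u : acyclic T -> T x v -> toward T x v u -> u = x.
Proof.
move=> acT xv xvu; apply: (toward_uniq acT xvu).
by rewrite /toward adj_sym xv connect0.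
Qed.

Lemma not_toward_leaf G T x z z1 : spanning_tree G T -> deg T z = 1 ->
  T z z1 -> x != z -> ~~ toward T x z1 z.
Proof.
move=> spT dz zz1 xz.
have [r xzr] := connect_toward (spanning_connected x z spT) xz.
have /andP[zr _] := xzr; rewrite (deg1_nbr dz zr zz1) in xzr.
exact: toward_asym (spanning_acyclic spT) xzr.
Qed.

Lemma toward_past_leaf G T x z z1 b : spanning_tree G T -> deg T z = 1 ->
    deg T z1 = 2 -> T z z1 -> T z1 b -> b != z -> x != z -> x != z1 ->
  toward T x z1 b.
Proof.
move=> spT dz dz1 zz1 z1b bz xz xz1.
have [r xz1r] := connect_toward (spanning_connected x z1 spT) xz1.
have rz : z != r.
  by apply: contraTneq xz1r => <-; apply: not_toward_leaf spT dz zz1 xz.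
have /andP[z1r _] := xz1r; rewrite adj_sym in zz1.
by rewrite -(deg2_nbr dz1 zz1 z1r z1b rz _) // eq_sym.
Qed.

(** The new edge xv replaces the step from v to its parent. *)
Lemma reroute_spanning G T x v u : spanning_tree G T -> G x v -> ~~ T x v ->
  toward T x v u -> spanning_tree G (swap T x v v u).
Proof.
move=> spT Gxv Txv xvu; have xv := towardN xvu.
case/andP: (xvu) => vu c_xu; apply: swap_spanning => //.
apply: connect_trans (connect_swap x v u c_xu).
by rewrite connect_sym_adj; apply/connect1/swap_new.
Qed.

(** In a triangle b, c, c' the vertex c' may hang from c instead of b. *)
Lemma shift_spanning G T b c c' : spanning_tree G T -> T b c -> T b c' ->
  c != c' -> G c c' -> spanning_tree G (swap T c c' b c') /\ ~~ T c c'.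
Proof.
move=> spT bc bc' cc' Gcc'.
have Tcc' : ~~ T c c'.
  apply/negP=> Tcc'; have /(_ [:: b; c; c']) := spanning_acyclic spT.
  rewrite /ucycle /= bc Tcc' adj_sym bc' !inE negb_or (adj_neq bc).
  by rewrite (adj_neq bc') cc' => /(_ isT).
split=> //; apply: swap_spanning => //; apply: (@connect_trans _ _ c).
  by apply/connect1/swap_old => //; rewrite endsF ?(adj_neq bc').
by apply/connect1/swap_new.
Qed.

(** b is the vertex where the path from z reaches the path from x to y. *)
Lemma median T x y z : connected T -> deg T x = 1 -> deg T y = 1 ->
    deg T z = 1 -> x != y -> x != z -> y != z ->
  exists b b' b'',
    [/\ toward T x b b', toward T y b b'', b' != b'' & 2 < deg T b].
Proof.
move=> cT dx dy dz xy xz yz.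
have [p [pth e un]] := connect_last (proj2 cT x y) xy.
have inner b : b \in p -> exists b' b'', [/\ toward T x b b', toward T y b b'',
    b' != b'', b' \in x :: rcons p y & b'' \in x :: rcons p y].
  move=> bp; move: pth e un; case/splitPr: bp => p1 p2.
  rewrite rcons_cat -cat_cons cat_uniq /= last_cat cat_path /=.
  case/and3P=> pth1 e1 pth2 e2 /and3P[/andP[xp1 un1] + /andP[bp2 un2]].
  rewrite negb_or => /andP[bp1 dis].
  have bx : x != b by apply: contraNneq bp1 => ->; rewrite mem_head.
  set s := head y p2.
  have sp2 : s \in rcons p2 y by rewrite /s; case: (p2) => [|? ?]; rewrite /= mem_head.
  exists (last x p1), s; split.
  - apply: path_toward => //; rewrite -rcons_cons rcons_uniq bp1.
    by rewrite /= xp1.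
  - have pp : path T b (rcons p2 y) by rewrite rcons_path pth2.
    rewrite /toward /s; move: pp bp2 {sp2 s un2 dis e2 pth2}.
    case: p2 => [|s p2] /=; first by rewrite andbT connect0 => ->.
    case/andP=> -> pp bp2; rewrite /= avoid_sym.
    apply/connectP; exists (rcons p2 y); last by rewrite last_rcons.
    exact: path_avoid.
  - apply: contraNneq dis => def_s; apply/hasP; exists s => //.
    by rewrite -def_s mem_last.
  - by rewrite -cat_cons mem_cat mem_last.
  by rewrite -cat_cons mem_cat [s \in b :: _]inE sp2 !orbT.
have zP : z \notin x :: rcons p y.
  rewrite inE mem_rcons inE !negb_or ![z == _]eq_sym xz yz /=.
  apply/negP=> /inner[b' [b'' [/andP[zb' _] /andP[zb'' _] b'b'' _ _]]].
  by have := leq_deg2 zb' zb'' b'b''; rewrite dz.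
have [/existsP[b /existsP[w /and3P[bP bw wP]]]|noexit] := boolP
    [exists b, exists w, [&& b \in x :: rcons p y, T b w & w \notin x :: rcons p y]].
  have bp : b \in p.
    move: bP; rewrite inE mem_rcons inE => /or3P[/eqP def_b|/eqP def_b|//].
      case/negP: wP; rewrite def_b in bw.
      have [t xt tP] : exists2 t, T x t & t \in rcons p y.
        exists (head y p); last by case: (p) => [|? ?]; rewrite /= mem_head.
        by case: (p) pth e => [|t p'] //= /andP[].
      by rewrite (deg1_nbr dx bw xt) inE tP orbT.
    case/negP: wP; rewrite def_b in bw; rewrite adj_sym in e.
    by rewrite (deg1_nbr dy bw e) -rcons_cons mem_rcons inE mem_last orbT.
  have [b' [b'' [xbb' ybb'' b'b'' b'P b''P]]] := inner b bp.
  exists b, b', b''; split=> //; case/andP: xbb' => bb' _; case/andP: ybb'' => bb'' _.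
  apply: (leq_deg3 bb' bb'' bw) => //; first by apply: contraNneq wP => <-.
  by apply: contraNneq wP => <-.
have [q pq def_z] := connectP (proj2 cT x z).
suffices : z \in x :: rcons p y by rewrite (negPf zP).
suffices stay r : path T r q -> r \in x :: rcons p y -> last r q \in x :: rcons p y.
  by rewrite def_z stay ?mem_head.
elim: q r {pq def_z} => //= s q IHq r /andP[rs pq] rP; apply: IHq pq _.
apply: contraNT noexit => sP; apply/existsP; exists r; apply/existsP; exists s.
by rewrite rP rs.
Qed.

(** * Optimal spanning trees *)

(** In a tree with at least two vertices these are the leaves and the branch
    vertices; a single condition on degrees makes two trees easy to compare. *)
Definition special T : {set V} := [set v | deg T v != 2].

Definition optimal G T : Prop :=
  spanning_tree G T /\
  forall T', spanning_tree G T' -> #|special T| <= #|special T'|.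

Lemma ex_optimal G : connected G -> exists T, optimal G T.
Proof.
case/spanning_subtree=> T; have [m] := ubnP #|special T|.
elim: m T => // m IHm T lt_m spT.
have [[T' [spT' lt_T']]|noT'] :=
    classic (exists T', spanning_tree G T' /\ #|special T'| < #|special T|).
  by apply: IHm spT'; apply: leq_trans lt_T' _.
exists T; split=> // T' spT'; rewrite leqNgt; apply/negP=> lt_T'.
by apply: noT'; exists T'.
Qed.

Lemma optimal_trans G T T' : optimal G T -> spanning_tree G T' ->
  #|special T'| <= #|special T| -> optimal G T'.
Proof.
by move=> [_ minT] spT' le_T'; split=> // S /minT; apply: leq_trans.
Qed.

(** The shape in which optimality is contradicted most often: the exchange turns
    x into a vertex of degree 2 and preserves all such vertices. *)
Lemma no_gain G T T' x : optimal G T -> spanning_tree G T' ->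
    deg T x != 2 -> deg T' x = 2 ->
  (forall v, deg T v = 2 -> deg T' v = 2) -> False.
Proof.
move=> [_ minT] /minT le_T dx dx' dT; move: le_T; apply/negP; rewrite -ltnNge.
apply/proper_card/properP; split; last by exists x; rewrite !inE ?dx ?dx'.
by apply/subsetP=> v; rewrite !inE; apply: contraNneq => /dT->.
Qed.

(** An edge xy of G closes a cycle through the median b of x, y and a third
    leaf; removing the cycle edge bb' makes x and y disappear from the special
    vertices, and only b' may join them. *)
Lemma leaves_nonadjacent G T x y z : optimal G T -> deg T x = 1 ->
  deg T y = 1 -> deg T z = 1 -> x != y -> x != z -> y != z -> ~~ G x y.
Proof.
move=> optT dx dy dz xy xz yz; apply/negP=> Gxy; have [spT minT] := optT.
have cT u v := spanning_connected u v spT; have acT := spanning_acyclic spT.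
have Txy : ~~ T x y.
  apply/negP=> Txy; have Tyx : T y x by rewrite adj_sym.
  have [|r zxr] := connect_toward (cT z x); first by rewrite eq_sym.
  have [|s zys] := connect_toward (cT z y); first by rewrite eq_sym.
  have /andP[xr _] := zxr; have /andP[ys _] := zys.
  rewrite (deg1_nbr dx xr Txy) in zxr; rewrite (deg1_nbr dy ys Tyx) in zys.
  by have := toward_asym acT zxr; rewrite zys.
have [b [b' [b'' [xbb' ybb'' b'b'' db]]]] := median (proj1 (proj2 spT)) dx dy dz xy xz yz.
have /andP[bb' c_xb'] := xbb'; have /andP[bb'' c_yb''] := ybb''.
have spS : spanning_tree G (swap T x y b b').
  apply: swap_spanning => //; apply: (@connect_trans _ _ b'').
    by apply/connect1/swap_old => //; rewrite endsF ?(adj_neq bb') // eq_sym.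
  apply: (@connect_trans _ _ y).
    by rewrite connect_sym_adj; apply: connect_swap.
  apply: (@connect_trans _ _ x); last exact: connect_swap.
  by rewrite connect_sym_adj; apply/connect1/swap_new.
have dS v := deg_swap v xy bb' Txy.
have [bx by_] : b != x /\ b != y.
  by split; apply: contraTneq db => ->; rewrite ?dx ?dy.
have b'y : b' != y.
  apply: contraNneq Txy => def_b'; rewrite def_b' in xbb' bb'.
  rewrite adj_sym; have [|s xys] := connect_toward (cT x y) => //.
  have := toward_asym acT xbb'; case/andP: (xys) => ys _.
  by rewrite adj_sym in bb'; rewrite -(deg1_nbr dy ys bb') xys.
have keep v : v != b' -> deg T v = 2 -> deg (swap T x y b b') v = 2.
  move=> vb' dv; have := dS v; rewrite dv (negPf vb').
  have -> : (v == b) = false by apply: contraTF db => /eqP<-; rewrite dv.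
  have -> : (v == x) = false by apply: contra_eqF dx => /eqP<-; rewrite dv.
  have -> : (v == y) = false by apply: contra_eqF dy => /eqP<-; rewrite dv.
  by rewrite !addn0.
have dy' : deg (swap T x y b b') y = 2.
  have := dS y; rewrite dy ![y == _]eq_sym eqxx (negPf xy) (negPf by_) (negPf b'y).
  by rewrite !addn0.
have [def_b'|b'x] := eqVneq b' x.
  apply: (no_gain optT spS _ dy') => [|v dv]; first by rewrite dy.
  by apply: keep => //; rewrite def_b'; apply/eqP=> vx; rewrite vx dx in dv.
have dx' : deg (swap T x y b b') x = 2.
  have := dS x; rewrite dx ![x == b]eq_sym eqxx [x == b']eq_sym (negPf xy) (negPf bx).
  by rewrite (negPf b'x) !addn0.
have := minT _ spS; apply/negP; rewrite -ltnNge.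
have : #|special (swap T x y b b') :\ b'| < #|special T :\ x|.
  apply/proper_card/properP; split.
    apply/subsetP=> v; rewrite !inE => /andP[vb' dv]; apply/andP; split.
      by apply: contraNneq dv => ->; rewrite dx'.
    by apply: contraNneq dv => /(keep v vb')->.
  by exists y; rewrite !inE ?dy ?dy' eq_sym ?xy // andbF.
have := cardsD1 b' (special (swap T x y b b')); have := cardsD1 x (special T).
rewrite [x \in _]inE dx /=; clear; lia.
Qed.

Lemma deg_neq T u v : deg T u != deg T v -> u != v.
Proof. by apply: contraNneq => ->. Qed.

Lemma parent_new G T x v u : optimal G T -> toward T x v u -> u != x -> ~~ T x v.
Proof.
move=> [spT _] xvu; apply: contraNN => Txv.
by rewrite (toward_adj (spanning_acyclic spT) Txv xvu).
Qed.

(** Otherwise T + xv - vu is better: x gets degree 2, and u had another degree. *)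
Lemma parent_deg2 G T x v u : optimal G T -> deg T x = 1 -> G x v ->
  toward T x v u -> u != x -> deg T u = 2.
Proof.
move=> optT dx Gxv xvu ux; have Txv := parent_new optT xvu ux.
have /andP[vu _] := xvu; have xv := towardN xvu.
apply/eqP; case: eqP => // /eqP du; exfalso.
have dS w := deg_swap w xv vu Txv.
apply: (no_gain (x := x) optT (reroute_spanning (proj1 optT) Gxv Txv xvu)).
- by rewrite dx.
- have := dS x; rewrite dx eqxx (negPf xv) [x == u]eq_sym (negPf ux).
  by rewrite !addn0.
move=> w dw; have := dS w; rewrite dw.
have /negPf-> : w != x by apply: (@deg_neq T); rewrite dw dx.
have /negPf-> : w != u by apply: (@deg_neq T); rewrite dw eq_sym.
by rewrite addn0 add0n => /addIn.
Qed.

(** The leaf x is traded for the leaf u. *)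
Lemma reroute_optimal G T x v u : optimal G T -> deg T x = 1 -> G x v ->
    toward T x v u -> u != x ->
  optimal G (swap T x v v u) /\ deg (swap T x v v u) u = 1.
Proof.
move=> optT dx Gxv xvu ux; have Txv := parent_new optT xvu ux.
have du := parent_deg2 optT dx Gxv xvu ux.
have /andP[vu _] := xvu; have xv := towardN xvu; have uv := adj_neq vu.
have dS w := deg_swap w xv vu Txv.
have du' : deg (swap T x v v u) u = 1.
  have := dS u; rewrite du eqxx (negPf ux) [u == v]eq_sym (negPf uv).
  by rewrite !addn0 add0n addn1 => -[].
have dx' : deg (swap T x v v u) x = 2.
  have := dS x; rewrite dx eqxx (negPf xv) [x == u]eq_sym (negPf ux).
  by rewrite !addn0.
split=> //; apply: (optimal_trans optT).
  exact: reroute_spanning (proj1 optT) Gxv Txv xvu.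
apply: (@leq_trans #|u |: special T :\ x|).
  apply/subset_leq_card/subsetP=> w; rewrite !inE => dw.
  case: eqP => //= /eqP wu; apply/andP; split.
    by apply: contraNneq dw => ->; rewrite dx'.
  apply: contraNneq dw => dw; have := dS w; rewrite dw (negPf wu).
  have /negPf-> : w != x by apply: (@deg_neq T); rewrite dw dx.
  by rewrite addn0 add0n => /addIn->.
by rewrite cardsU1 !inE du andbF (cardsD1 x (special T)) inE dx.
Qed.

(** After rerouting, u and y are two leaves of an optimal tree, with z as the
    third leaf. *)
Lemma parent_nonadjacent G T x y z v u : optimal G T -> deg T x = 1 ->
    deg T y = 1 -> deg T z = 1 -> x != y -> x != z -> y != z ->
  G x v -> toward T x v u -> ~~ G u y.
Proof.
move=> optT dx dy dz xy xz yz Gxv xvu.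
have [->|ux] := eqVneq u x.
  exact: leaves_nonadjacent optT dx dy dz xy xz yz.
have Gxy := leaves_nonadjacent optT dx dy dz xy xz yz.
have Gxz : ~~ G x z by apply: leaves_nonadjacent optT dx dz dy xz xy _; rewrite eq_sym.
have du := parent_deg2 optT dx Gxv xvu ux.
have [optS du'] := reroute_optimal optT dx Gxv xvu ux.
have Txv := parent_new optT xvu ux; have /andP[vu _] := xvu.
have xv := towardN xvu.
have uy : u != y by apply: (@deg_neq T); rewrite du dy.
have uz : u != z by apply: (@deg_neq T); rewrite du dz.
have keep w : w != x -> w != u -> ~~ G x w -> deg (swap T x v v u) w = deg T w.
  move=> wx wu Gxw; have wv : w != v by apply: contraNneq Gxw => ->.
  exact: deg_swapN.
apply: (leaves_nonadjacent (z := z) optS) => //.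
  by rewrite keep // eq_sym.
by rewrite keep // eq_sym.
Qed.

Lemma shift_deg T b c c' w : T b c' -> ~~ T c c' -> c != c' ->
  deg (swap T c c' b c') w + (w == b) = deg T w + (w == c).
Proof.
by move=> bc' Tcc' cc'; have := deg_swap w cc' bc' Tcc'; rewrite !addnA => /addIn.
Qed.

(** Hanging c' from c would remove the leaf c. *)
Lemma sibling_not_leaf G T b c c' : optimal G T -> T b c -> T b c' ->
  c != c' -> G c c' -> 2 < deg T b -> deg T c != 1.
Proof.
move=> optT bc bc' cc' Gcc' db; apply/eqP=> dc.
have [spS Tcc'] := shift_spanning (proj1 optT) bc bc' cc' Gcc'.
have dS w := shift_deg w bc' Tcc' cc'; have nbc := adj_neq bc.
apply: (no_gain (x := c) optT spS); first by rewrite dc.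
  by have := dS c; rewrite dc eqxx eq_sym (negPf nbc) addn0.
move=> w dw; have := dS w; rewrite dw.
have /negPf-> : w != c by apply: (@deg_neq T); rewrite dw dc.
have /negPf-> : w != b by apply: (@deg_neq T); rewrite dw neq_ltn db.
by rewrite !addn0.
Qed.

(** * Branch vertices adjacent to a leaf *)

Lemma claw_free_adj G b u v w : claw_free G -> G b u -> G b v -> G b w ->
  u != v -> u != w -> v != w -> [|| G u v, G u w | G v w].
Proof.
move=> clawG bu bv bw uv uw vw; apply/negPn/negP; rewrite !negb_or => /and3P[nuv nuw nvw].
apply: clawG; exists (tnth [tuple b; u; v; w]).
  apply/tuple_uniqP; rewrite /= !inE !negb_or (adj_neq bu) (adj_neq bv).
  by rewrite (adj_neq bw) uv uw vw.
move=> i j; rewrite /claw !(tnth_nth b).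
case: i => -[|[|[|[|//]]]] ?; case: j => -[|[|[|[|//]]]] ? /=;
  rewrite ?adj_irrefl //;
  first [by apply: negbTE | by apply: negbTE; rewrite adj_sym
        | by rewrite adj_sym].
Qed.

Section ClawFree.
Variables (G : sgraph V) (clawG : claw_free G).

Lemma away_child T y b q c : spanning_tree G T -> toward T y b q ->
  T b c -> c != q -> toward T y c b.
Proof.
move=> spT ybq bc cq.
have := toward_total (spanning_connected y b spT) bc.
case/orP=> // ybc; case/eqP: cq.
exact: toward_uniq (spanning_acyclic spT) ybc ybq.
Qed.

(** By [parent_deg2] for the root y, since the parent of c is a branch vertex. *)
Lemma child_nonadjacent T y b q c : optimal G T -> deg T y = 1 -> G y b ->
  2 < deg T b -> toward T y b q -> T b c -> c != q -> ~~ G y c.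
Proof.
move=> optT dy Gyb db ybq bc cq; apply/negP=> Gyc.
have ycb := away_child (proj1 optT) ybq bc cq.
have := parent_deg2 optT dy Gyc ycb; rewrite eq_sym => /(_ (adj_neq Gyb)) db2.
by rewrite db2 in db.
Qed.

Lemma children_adjacent T y b q c c' : optimal G T -> deg T y = 1 -> G y b ->
  2 < deg T b -> toward T y b q -> T b c -> c != q -> T b c' -> c' != q ->
  c != c' -> G c c'.
Proof.
move=> optT dy Gyb db ybq bc cq bc' c'q cc'.
have sT := proj1 (proj1 optT).
have yc := towardN (away_child (proj1 optT) ybq bc cq).
have yc' := towardN (away_child (proj1 optT) ybq bc' c'q).
have Gby : G b y by rewrite adj_sym.
have := claw_free_adj clawG Gby (sT _ _ bc) (sT _ _ bc') yc yc' cc'.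
rewrite (negPf (child_nonadjacent optT dy Gyb db ybq bc cq)).
by rewrite (negPf (child_nonadjacent optT dy Gyb db ybq bc' c'q)).
Qed.

(** If c is a branch vertex, hang the other children of b from c, one by one.
    The special vertices do not change until b is left with degree 2, which
    contradicts optimality; hence the induction on the degree of b, over all
    optimal trees. *)
Lemma child_deg2 T y b q c : optimal G T -> deg T y = 1 -> G y b ->
  2 < deg T b -> toward T y b q -> T b c -> c != q -> deg T c = 2.
Proof.
have [m] := ubnP (deg T b); elim: m T => // m IHm T lt_m optT dy Gyb db ybq bc cq.
have [c' [bc' c'q c'c]] := deg3_other q c db; rewrite eq_sym in c'c.
have Gcc' := children_adjacent optT dy Gyb db ybq bc cq bc' c'q c'c.
have dc1 := sibling_not_leaf optT bc bc' c'c Gcc' db.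
have cb : T c b by rewrite adj_sym.
have dc0 : 0 < deg T c by apply/card_gt0P; exists b; rewrite inE.
apply/eqP; case: ltngtP => // [|dc]; first by case: (deg T c) dc0 dc1 => [|[|]].
have [spS Tcc'] := shift_spanning (proj1 optT) bc bc' c'c Gcc'.
have dS w := shift_deg w bc' Tcc' c'c; have nbc := adj_neq bc.
have dSb : (deg (swap T c c' b c') b).+1 = deg T b.
  by have := dS b; rewrite eqxx (negPf nbc) addn0 addn1.
have dSc : deg (swap T c c' b c') c = (deg T c).+1.
  by have := dS c; rewrite eqxx eq_sym (negPf nbc) addn0 addn1.
have keep w : w != b -> w != c -> deg (swap T c c' b c') w = deg T w.
  by move=> /negPf wb /negPf wc; have := dS w; rewrite wb wc !addn0.
have keep2 w : deg T w = 2 -> deg (swap T c c' b c') w = 2.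
  move=> dw; rewrite keep //; apply: (@deg_neq T).
    by rewrite dw neq_ltn db.
  by rewrite dw neq_ltn dc.
have [db3|db3] := eqVneq (deg T b) 3.
  case: (no_gain (x := b) optT spS) => //; first by rewrite db3.
  by move: dSb; rewrite db3 => -[].
have optS : optimal G (swap T c c' b c').
  apply: optimal_trans optT spS _; apply/subset_leq_card/subsetP=> w.
  by rewrite !inE; apply: contraNneq => /keep2->.
have nyc := towardN (away_child (proj1 optT) ybq bc cq).
have bq : T b q by case/andP: ybq.
suffices : deg (swap T c c' b c') c = 2 by rewrite dSc => -[dc']; rewrite dc' in dc.
apply: IHm => //.
- by rewrite dSb.
- by rewrite keep // (adj_neq Gyb).
- by rewrite -ltnS dSb ltn_neqAle eq_sym db3.
- rewrite /toward swap_old ?endsF ?(adj_neq bc') // 1?eq_sym //.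
  by apply: connect_avoid_swap; case/andP: ybq.
by apply: swap_old => //; rewrite endsF ?(adj_neq bc').
Qed.

(** * Counting around an optimal tree *)

(** Otherwise sending a leaf to its neighbour would embed the leaves into the
    branch vertices, injectively because a branch vertex next to a leaf has no
    other leaf next to it by [child_deg2]; but there are more leaves. *)
Lemma leaf_deg2_nbr T : optimal G T -> 2 < #|leaves T| ->
  exists z z1, [/\ deg T z = 1, T z z1 & deg T z1 = 2].
Proof.
move=> optT L3; have [spT _] := optT; have [sT tT] := spT.
pose f z := odflt z [pick w | T z w].
have fP z : z \in leaves T -> T z (f z).
  rewrite inE /f => /eqP dz; case: pickP => //= no.
  have /card_gt0P[w] : 0 < deg T z by rewrite dz.
  by rewrite inE no.
have [/existsP[z /andP[zL /eqP d2]]|no] :=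
    boolP [exists z, (z \in leaves T) && (deg T (f z) == 2)].
  exists z, (f z); split=> //; last exact: fP.
  by move: zL; rewrite inE => /eqP.
have fB z : z \in leaves T -> 2 < deg T (f z).
  move=> zL; have zf := fP z zL; have := zL; rewrite inE => /eqP dz.
  have f0 : 0 < deg T (f z).
    by apply/card_gt0P; exists z; rewrite inE adj_sym.
  have d2 : deg T (f z) != 2.
    by apply: contraNneq no => d2; apply/existsP; exists z; rewrite zL d2.
  case: ltngtP => // lt_d; last by rewrite -lt_d in d2.
  have d1 : deg T (f z) = 1 by case: (deg T (f z)) f0 lt_d => [|[|]].
  (* A third leaf, so that the adjacent leaves z and f z are excluded. *)
  have [u [uL uz ufz]] : exists u, [/\ u \in leaves T, u != z & u != f z].
    have /card_gt0P[u] : 0 < #|leaves T :\ z :\ f z|.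
      have := cardsD1 z (leaves T); have := cardsD1 (f z) (leaves T :\ z).
      by move: L3; clear; lia.
    by rewrite !inE => /and3P[? ? ?]; exists u; rewrite inE.
  have du : deg T u = 1 by move: uL; rewrite inE => /eqP.
  rewrite eq_sym in uz; rewrite eq_sym in ufz.
  have /negP[] := leaves_nonadjacent optT dz d1 du (adj_neq zf) uz ufz.
  exact: sT.
have inj_f : {in leaves T &, injective f}.
  move=> z z' zL z'L eq_f; apply/eqP; case: eqP => // /eqP zz'.
  have dz : deg T z = 1 by move: zL; rewrite inE => /eqP.
  have dz' : deg T z' = 1 by move: z'L; rewrite inE => /eqP.
  have tz : toward T z (f z) z by rewrite /toward connect0 adj_sym fP.
  have fz' : T (f z) z' by rewrite adj_sym eq_f fP.
  have := child_deg2 optT dz (sT _ _ (fP z zL)) (fB z zL) tz fz'.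
  by rewrite eq_sym dz' => /(_ zz').
have : #|leaves T| <= #|branch_vertices T|.
  rewrite -(card_in_imset inj_f); apply/subset_leq_card/subsetP=> w.
  by case/imsetP=> z zL ->; rewrite inE fB.
have V1 : 1 < #|V| by apply: leq_trans (ltnW L3) (max_card _).
by have := leaves_branches tT V1; clear; lia.
Qed.

(** z1 is to be the extra vertex of the count.  It must not be adjacent to y,
    nor be a child of a branch vertex adjacent to y.  If its second neighbour b
    is a branch vertex, no leaf but z is adjacent to z1, and if two such leaves
    were adjacent to b they would form a claw with z1; otherwise, two leaves
    adjacent to z1 would form a claw with z. *)
Lemma choose_leaves T : optimal G T -> 2 < #|leaves T| ->
  exists x y z z1,
    [/\ [/\ deg T x = 1, deg T y = 1 & deg T z = 1],
        [/\ x != y, x != z & y != z], T z z1, deg T z1 = 2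
      & ~~ G y z1 /\ forall b, T z1 b -> 2 < deg T b -> ~~ G y b].
Proof.
move=> optT L3; have [z [z1 [dz zz1 dz1]]] := leaf_deg2_nbr optT L3.
have [spT _] := optT; have [sT _] := spT.
have [b z1b bz] := deg2_other z dz1.
have [u [w [uL wL uw]]] : exists u w,
    [/\ u \in leaves T :\ z, w \in leaves T :\ z & u != w].
  apply/card_gt1P; have := cardsD1 z (leaves T); move: L3; clear; lia.
move: uL wL; rewrite !inE => /andP[uz /eqP du] /andP[wz /eqP dw].
have nz1 x : deg T x = 1 -> x != z1.
  by move=> dx; apply: (@deg_neq T); rewrite dx dz1.
have cl : (~~ G u z1 /\ (2 < deg T b -> ~~ G u b)) \/
          (~~ G w z1 /\ (2 < deg T b -> ~~ G w b)).
  have nA x y t := @leaves_nonadjacent G T x y t optT.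
  have [zu zw wu] : [/\ z != u, z != w & w != u] by rewrite ![_ == u]eq_sym [z == w]eq_sym.
  have Guw := nA u w z du dw dz uw uz wz.
  have Gzu := nA z u w dz du dw zu zw uw.
  have Gzw := nA z w u dz dw du zw zu wu.
  have [db|db] := ltnP 2 (deg T b).
    have far x : deg T x = 1 -> x != z -> ~~ G x z1.
      move=> dx xz; apply/negP=> Gxz1.
      have xb := toward_past_leaf spT dz dz1 zz1 z1b bz xz (nz1 x dx).
      have bx : b != x by apply: (@deg_neq T); rewrite dx neq_ltn (ltnW db) orbT.
      by have := parent_deg2 optT dx Gxz1 xb bx => db2; rewrite db2 in db.
    have Guz1 := far u du uz; have Gwz1 := far w dw wz.
    have [Gub|] := boolP (G u b); last by left.
    have [Gwb|] := boolP (G w b); last by right.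
    have := @claw_free_adj G b z1 u w clawG.
    rewrite ![G b _]adj_sym (sT _ _ z1b) Gub Gwb ![G z1 _]adj_sym.
    rewrite (negPf Guz1) (negPf Gwz1) (negPf Guw) uw ![z1 == _]eq_sym.
    by rewrite !nz1 // => /(_ isT isT isT isT isT isT).
  have [Guz1|Guz1] := boolP (G u z1); last by left.
  have [Gwz1|Gwz1] := boolP (G w z1); last by right.
  have := @claw_free_adj G z1 z u w clawG.
  rewrite ![G z1 _]adj_sym (sT _ _ zz1) Guz1 Gwz1 zu zw uw.
  by rewrite (negPf Guw) (negPf Gzu) (negPf Gzw) => /(_ isT isT isT isT isT isT).
have ext y : (2 < deg T b -> ~~ G y b) ->
    forall t, T z1 t -> 2 < deg T t -> ~~ G y t.
  move=> far t z1t dt; have tz : z != t.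
    by apply: (@deg_neq T); rewrite dz neq_ltn (ltnW dt).
  have z1z : T z1 z by rewrite adj_sym.
  have tb : t = b by apply: deg2_nbr dz1 z1z z1t z1b tz _; rewrite eq_sym.
  by rewrite tb in dt *; apply: far.
case: cl => -[G1 G2]; [exists w, u, z, z1 | exists u, w, z, z1]; split=> //.
- by rewrite eq_sym.
- by split=> //; apply: ext.
- by split=> //; apply: ext.
Qed.

(** A is the set of the parents of N(x) and D is N(y); phi embeds the special
    vertices into the complement of their disjoint union. *)
Lemma deg_sum_bound T : optimal G T -> 2 < #|leaves T| ->
  exists x y, [/\ x != y, ~~ G x y & deg G x + deg G y + #|special T| <= #|V|].
Proof.
move=> optT L3; have [spT _] := optT; have [sT tT] := spT.
have acT := proj2 tT; have cT u v := spanning_connected u v spT.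
have [x [y [z [z1 [[dx dy dz] [xy xz yz] zz1 dz1 [Gyz1 Gyb]]]]]] := choose_leaves optT L3.
have [zx zy yx] : [/\ z != x, z != y & y != x] by rewrite ![_ == x]eq_sym [z == y]eq_sym.
have Gxy := leaves_nonadjacent optT dx dy dz xy xz yz.
have Gxz := leaves_nonadjacent optT dx dz dy xz xy zy.
exists x, y; split=> //.
pose par r v := odflt v [pick u | toward T r v u].
have parP r v : r != v -> toward T r v (par r v).
  move=> rv; rewrite /par; case: pickP => //= no.
  by have [u] := connect_toward (cT r v) rv; rewrite no.
pose Nx := [set v | G x v]; pose A := par x @: Nx; pose D := [set v | G y v].
have NxP v : v \in Nx -> G x v /\ toward T x v (par x v).
  by rewrite inE => Gxv; split=> //; apply/parP/(adj_neq Gxv).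
have A_P u : u \in A -> exists2 v, G x v & toward T x v u.
  by case/imsetP=> v /NxP[Gxv xvp] ->; exists v.
have Adeg2 u : u \in A -> u != x -> deg T u = 2.
  by case/A_P=> v Gxv xvu ux; apply: parent_deg2 optT dx Gxv xvu ux.
(* A vertex of degree 2 other than the root has a single child. *)
have cardA : #|A| = deg G x.
  apply: card_in_imset => v v' /NxP[Gxv xvu] /NxP[Gxv' xvu'] eq_u.
  rewrite -eq_u in xvu'; move: xvu xvu'; set u := par x v => xvu xvu'.
  have /andP[vu _] := xvu; have /andP[v'u _] := xvu'.
  rewrite adj_sym in vu; rewrite adj_sym in v'u.
  have [ux|ux] := eqVneq u x; first by rewrite ux in vu v'u; apply: deg1_nbr dx vu v'u.
  have du := parent_deg2 optT dx Gxv xvu ux; rewrite eq_sym in ux.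
  have xur := parP x u ux; have /andP[ur _] := xur.
  apply: deg2_nbr du ur vu v'u _ _.
    apply: contraTneq xur => ->; exact: toward_asym xvu.
  apply: contraTneq xur => ->; exact: toward_asym xvu'.
have disjAD u : u \in A -> u \notin D.
  case/A_P=> v Gxv xvu; rewrite inE adj_sym.
  exact: parent_nonadjacent optT dx dy dz xy xz yz Gxv xvu.
pose br s := (2 < deg T s) && G y s.
pose child s := odflt s [pick c | [&& T s c, c != par y s & c != par x s]].
have childP s : br s -> [/\ T s (child s), child s != par y s & child s != par x s].
  case/andP=> ds _; rewrite /child; case: pickP => [c /and3P[]//|no] /=.
  by have [c [sc c1 c2]] := deg3_other (par y s) (par x s) ds; have := no c; rewrite sc c1 c2.
have ys s : br s -> y != s by case/andP=> _; apply: adj_neq.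
have child2 s : br s -> deg T (child s) = 2.
  move=> brs; have [sc c1 _] := childP s brs; have [ds Gys] := andP brs.
  exact: child_deg2 optT dy Gys ds (parP y s (ys s brs)) sc c1.
have childD s : br s -> child s \notin D.
  move=> brs; have [sc c1 _] := childP s brs; have [ds Gys] := andP brs.
  rewrite inE.
  exact: child_nonadjacent optT dy Gys ds (parP y s (ys s brs)) sc c1.
(* If child s were the parent of some v in N(x), rerouting x to v would make it
   a leaf next to a branch vertex s with another child adjacent to it. *)
have childA s : br s -> child s \notin A.
  move=> brs; have [sc cy cx] := childP s brs; have [ds Gys] := andP brs.
  have dc := child2 s brs; move: sc cy cx dc; set c := child s => sc cy cx dc.
  apply/negP=> /A_P[v Gxv xvc]; have /andP[vc _] := xvc.
  have sv : s != v.
    apply: contraNneq cx => sv; rewrite sv.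
    by apply/eqP/(toward_uniq acT xvc)/parP/(adj_neq Gxv).
  have cNx : c != x by apply: (@deg_neq T); rewrite dc dx.
  have [optS dc'] := reroute_optimal optT dx Gxv xvc cNx.
  have [c' [sc' c'y c'c]] := deg3_other (par y s) c ds; rewrite eq_sym in c'c.
  have Gcc' := children_adjacent optT dy Gys ds (parP y s (ys s brs)) sc cy sc' c'y c'c.
  have nsc := adj_neq sc.
  have old t : T s t -> swap T x v v c s t.
    by move=> st; apply: swap_old => //; rewrite /ends /= (negPf sv) (negPf nsc).
  have dsS : deg (swap T x v v c) s = deg T s.
    apply: deg_swapN => //; first exact: towardN xvc.
      exact: parent_new optT xvc cNx.
    by apply: (@deg_neq T); rewrite dx neq_ltn (ltnW ds) orbT.
  have := sibling_not_leaf optS (old _ sc) (old _ sc') c'c Gcc'.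
  by rewrite dsS dc' => /(_ ds).
pose phi s := if s == x then z1 else if br s then child s else s.
have z1A : z1 \notin A.
  apply/negP=> /A_P[v Gxv xvz1]; have /andP[vz1 _] := xvz1; rewrite adj_sym in vz1.
  have vz : v != z by apply: contraNneq Gxz => <-.
  have xz1 : x != z1 by apply: (@deg_neq T); rewrite dx dz1.
  have := toward_past_leaf spT dz dz1 zz1 vz1 vz xz xz1.
  exact/negP/toward_asym.
have phiAD s : s \in special T -> (phi s \notin A) && (phi s \notin D).
  rewrite inE /phi => ds; case: eqP => [_|/eqP sx]; first by rewrite z1A inE.
  have [brs|] := boolP (br s); first by rewrite childA // childD.
  rewrite /br negb_and => brs; have sA : s \notin A.
    by apply: contraNN ds => /Adeg2/(_ sx)->.
  rewrite sA inE /=; case/orP: brs => // ds3.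
  have ds1 : deg T s = 1.
    have xs : x != s by rewrite eq_sym.
    have := deg_gt0 (proj1 tT) xs; move: ds ds3; clear.
    by case: (deg T s) => [|[|[|]]].
  have [->|sy] := eqVneq s y; first by rewrite adj_irrefl.
  by apply: leaves_nonadjacent optT dy ds1 dx _ _ sx; rewrite // eq_sym.
have z1child s : br s -> child s != z1.
  move=> brs; have [sc _ _] := childP s brs; have [ds Gys] := andP brs.
  by apply: contraTneq Gys => def_c; apply: Gyb => //; rewrite adj_sym -def_c.
(* The values of phi of degree 2 are z1 and the chosen children; a child
   determines its parent for the root y. *)
have inj_phi : {in special T &, injective phi}.
  move=> s t; rewrite !inE /phi => ds dt.
  have [->|sx] := eqVneq s x; have [-> //|tx] := eqVneq t x.
  - have [brt|_] := boolP (br t) => eq_st; last by rewrite -eq_st dz1 in dt.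
    by have := z1child t brt; rewrite -eq_st eqxx.
  - have [brs|_] := boolP (br s) => eq_st; last by rewrite eq_st dz1 in ds.
    by have := z1child s brs; rewrite eq_st eqxx.
  have [brs|_] := boolP (br s); have [brt|_] := boolP (br t) => // eq_st.
  - have [sc c1 _] := childP s brs; have [tc c2 _] := childP t brt.
    have p1 := away_child spT (parP y s (ys s brs)) sc c1.
    have p2 := away_child spT (parP y t (ys t brt)) tc c2.
    by rewrite -eq_st in p2; apply: toward_uniq acT p1 p2.
  - by rewrite -eq_st child2 in dt.
  - by rewrite eq_st child2 in ds.
have AD0 : A :&: D = set0.
  by apply/setP=> u; rewrite !inE; apply/negbTE/andP=> -[/disjAD/negP]; rewrite inE.
have sub : phi @: special T \subset ~: (A :|: D).
  by apply/subsetP=> _ /imsetP[s /phiAD + ->]; rewrite !inE negb_or.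
have := subset_leq_card sub; rewrite card_in_imset //.
have := cardsC (A :|: D); rewrite cardsU AD0 cards0 subn0 cardA -/(deg G y).
by clear; lia.
Qed.

End ClawFree.
End Trees.

(** * The degree condition *)

Lemma sigma2_le (V : finType) (G : sgraph V) x y : x != y -> ~~ G x y ->
  (sigma 2 G <= ((deg G x + deg G y)%N%:Z)%:E)%E.
Proof.
move=> xy Gxy.
have ind : independent G [set x; y].
  apply/forall_inP=> u /set2P[] ->; apply/forall_inP=> w /set2P[] ->;
  by rewrite ?adj_irrefl // adj_sym.
have c2 : #|[set x; y]| = 2 by rewrite cards2 xy.
have a2 : 2 <= alpha G.
  by apply: (bigop.bigmax_sup [set x; y]); rewrite // c2.
rewrite /sigma ltnNge a2 /=.
have -> : deg G x + deg G y = \sum_(v in [set x; y]) deg G v.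
  by rewrite (big_setD1 x) ?set21 //= setU1K ?inE // big_set1.
by apply: bigmin_le_cond; rewrite ind c2.
Qed.

Theorem corollary1p10 (k : nat) (V : finType) (G : sgraph V)
    (hk : 0 < k) (hconn : connected G) (hclaw : claw_free G)
    (hsigma : ((#|V|%:Z - k%:Z - 1)%R%:E <= sigma 2 G)%E) :
  exists T : sgraph V,
    spanning_tree G T /\ #|leaves T| + #|branch_vertices T| <= k + 1.
Proof.
have [T optT] := ex_optimal hconn; have [spT _] := optT.
exists T; split=> //.
have [L3|L2] := ltnP 2 #|leaves T|.
  have [x [y [xy Gxy le_V]]] := deg_sum_bound hclaw optT L3.
  have LB : #|leaves T| + #|branch_vertices T| <= #|special T|.
    rewrite -cardsUI [_ :&: _](_ : _ = set0) ?cards0 ?addn0.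
      apply/subset_leq_card/subsetP=> v; rewrite !inE.
      by case: (deg T v) => [|[|[|]]].
    by apply/setP=> v; rewrite !inE; case: (deg T v) => [|[|[|]]].
  have := le_trans hsigma (sigma2_le xy Gxy); rewrite lee_fin.
  by move: le_V LB; clear; lia.
have [V1|V1] := ltnP 1 #|V|.
  by have := leaves_branches (proj2 spT) V1; move: L2 hk; clear; lia.
have -> : branch_vertices T = set0.
  apply/setP=> v; rewrite !inE; apply/negbTE; rewrite -ltnNge.
  by apply: leq_ltn_trans (max_card _) _; apply: leq_ltn_trans V1 _.
by rewrite cards0; move: L2 hk; clear; lia.
Qed.
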